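(* Let $K$ be a field containing $\mathbb{R}$ as a subfield, let $v_1,\ldots,v_m\in\mathbb{N}^s$, let $\mathcal{P}=\mathrm{conv}(v_1,\ldots,v_m)$, let $w_1,\ldots,w_p:\mathbb{R}^s\to\mathbb{R}$ be linear functions with $w_i(e_j)\in\mathbb{N}$ for all $i,j$, and let $w=(w_1,\ldots,w_p):\mathbb{R}^s\to\mathbb{R}^p$. The following hold. (a) $A_q^w(\mathcal{P})=K[t^aq^{w(a)}z^n\mid(a,n)\in\mathrm{cone}(\mathcal{P})\cap\mathbb{Z}^{s+1}]=K[t^aq^{w(a)}z^n\mid a\in n\mathcal{P}\cap\mathbb{Z}^s]$. (b) $A_q^w(\mathcal{P})=\bigoplus_{n=0}^\infty A_q^w(\mathcal{P})_n$ is a graded $K$-algebra whose $n$-th graded component is $A_q^w(\mathcal{P})_n:=\sum_{a\in n\mathcal{P}\cap\mathbb{Z}^s}Kt^aq^{w(a)}z^n$, and $\dim_K(A_q^w(\mathcal{P})_n)=E_{\mathcal{P}}(n)$ for all $n\ge0$. (c) $A(\mathcal{P}^w)=A_q^w(\mathcal{P})$ and $E_{\mathcal{P}}(n)=E_{\mathcal{P}^w}(n)$ for $n\ge1$. (d) There is a finite set $\mathcal{H}_{\mathcal{P}}=\{(c_i,d_i)\}_{i=1}^r$, $c_i\in\mathbb{Z}^s$, $d_i\in\mathbb{Z}$, such that $\mathrm{cone}(\mathcal{P})\cap\mathbb{Z}^{s+1}=\mathbb{N}\mathcal{H}_{\mathcal{P}}$, $A(\mathcal{P})=K[\mathbb{N}\mathcal{H}_{\mathcal{P}}]$,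 and $A(\mathcal{P}^w)=K[t^aq^{w(a)}z^n\mid a\in n\mathcal{P}\cap\mathbb{Z}^s]=K[\{t^{c_i}q^{w(c_i)}z^{d_i}\}_{i=1}^r]$. (e) The $q$-weighted multivariate Ehrhart series $F_{\mathcal{P}}^{q,w}(t,q,x)$ of $\mathcal{P}$ is a rational function.
   Context: $\mathbb{N}=\{0,1,2,\ldots\}$; $e_j$ is the $j$-th unit vector; $t^a=t_1^{a_1}\cdots t_s^{a_s}$ and $q^{w(a)}=q_1^{w_1(a)}\cdots q_p^{w_p(a)}$. For a lattice polytope $\mathcal{Q}\subset\mathbb{R}^N$, $\mathrm{cone}(\mathcal{Q})\subset\mathbb{R}^{N+1}$ is the cone generated by $\{(x,1):x\in\mathcal{Q}\cap\mathbb{Z}^N\}$, $E_{\mathcal{Q}}(n)=|n\mathcal{Q}\cap\mathbb{Z}^N|$ is its Ehrhart function, and its Ehrhart ring is the monomial ring $A(\mathcal{Q})=K[y^az^n\mid(a,n)\in\mathrm{cone}(\mathcal{Q})\cap\mathbb{Z}^{N+1}]$, the $K$-subalgebra generated by these monomials, in variables $y_1,\ldots,y_N$ and a grading variable $z$ (for $\mathcal{Q}=\mathcal{P}$ the $y$-variables are $t_1,\ldots,t_s$; for polytopes in $\mathbb{R}^{s+p}$ they are $t_1,\ldots,t_s,q_1,\ldots,q_p$). The $q$-weighted Ehrhart ring $A_q^w(\mathcal{P})$ is the $K$-subalgebra of $K[t_1,\ldots,t_s,q_1,\ldots,q_p,z]$ generated by the monomials $t^aq^{w(a)}z^n$ with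 $(a,n)\in\mathrm{cone}(\mathcal{P})\cap\mathbb{Z}^{s+1}$. The $q$-weight lifting polytope is $\mathcal{P}^w=\mathrm{conv}(\{(v_i,w(v_i))\}_{i=1}^m)\subset\mathbb{R}^{s+p}$. $\mathbb{N}\mathcal{H}$ is the semigroup of $\mathbb{N}$-linear combinations of elements of $\mathcal{H}$, and $K[\mathbb{N}\mathcal{H}]$ is its semigroup ring, identified with the $K$-span of the corresponding monomials. $F_{\mathcal{P}}^{q,w}(t,q,x)=\sum_{(a,n)\in\mathrm{cone}(\mathcal{P})\cap\mathbb{Z}^{s+1}}q^{w(a)}t^ax^n$; a power series is called a rational function if it is the expansion of one. *)

(* Defs.v *)
(* MathComp, with the real numbers and classical sets of MathComp-Analysis. *)
From mathcomp Require Export all_boot all_order all_algebra.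
From mathcomp Require Export finmap boolp classical_sets cardinality reals.
From mathcomp Require Export mpoly.

Set Implicit Arguments.
Unset Strict Implicit.
Unset Printing Implicit Defensive.

Import Order.TTheory GRing.Theory Num.Theory.

Local Open Scope classical_set_scope.
Local Open Scope ring_scope.

Section Polytopes.
Variable R : realType.

Definition conv_hull (m N : nat) (v : 'I_m -> 'rV[R]_N) : set 'rV[R]_N :=
  [set x | exists l : 'I_m -> R,
     [/\ forall i, 0 <= l i, \sum_i l i = 1 & x = \sum_i l i *: v i]].

Definition cone_gen (N : nat) (G : set 'rV[R]_N) : set 'rV[R]_N :=
  [set y | exists (k : nat) (g : 'I_k -> 'rV[R]_N) (l : 'I_k -> R),
     [/\ forall i, G (g i), forall i, 0 <= l i & y = \sum_i l i *: g i]].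

Definition int_vec (N : nat) (a : 'rV[int]_N) : 'rV[R]_N := map_mx intr a.

(* S `&` Z^N, as a set of integer vectors *)
Definition lattice_pts (N : nat) (S : set 'rV[R]_N) : set 'rV[int]_N :=
  [set a | S (int_vec a)].

(* (a, n), the grading coordinate being the last one *)
Definition with_height (T : Type) (N : nat) (a : 'rV[T]_N) (n : T) :
  'rV[T]_(N + 1) := row_mx a (const_mx n).

Definition cone (N : nat) (Q : set 'rV[R]_N) : set 'rV[R]_(N + 1) :=
  cone_gen [set with_height (int_vec a) 1 | a in lattice_pts Q].

Definition dilate (N : nat) (n : nat) (Q : set 'rV[R]_N) : set 'rV[R]_N :=
  [set n%:R *: x | x in Q].

(* fset_set is a junk value on infinite sets, but the dilates of a polytope
   are bounded and contain finitely many lattice points. *)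
Definition ehrhart (N : nat) (Q : set 'rV[R]_N) (n : nat) : nat :=
  #|` fset_set (lattice_pts (dilate n Q))|.

Definition dilate_slice (N : nat) (Q : set 'rV[R]_N) (n : nat) :
  set 'rV[int]_(N + 1) :=
  [set with_height a n%:Z | a in lattice_pts (dilate n Q)].

Definition weight_map (s p : nat) (w : 'I_p -> {scalar 'rV[R]_s})
  (x : 'rV[R]_s) : 'rV[R]_p := \row_i w i x.

Definition lifting_polytope (m s p : nat) (v : 'I_m -> 'rV[R]_s)
  (w : 'I_p -> {scalar 'rV[R]_s}) : set 'rV[R]_(s + p) :=
  conv_hull (fun i => row_mx (v i) (weight_map w (v i))).

(* The exponent vectors (a, w(a), n) of the monomials t^a q^w(a) z^n, for (a, n)
   in S; w(a) is a real vector, hence the equation in R^(s+p+1). *)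
Definition weight_exps (s p : nat) (w : 'I_p -> {scalar 'rV[R]_s})
  (S : set 'rV[int]_(s + 1)) : set 'rV[int]_(s + p + 1) :=
  [set u | exists (a : 'rV[int]_s) (n : int), S (with_height a n) /\
     int_vec u =
     with_height (row_mx (int_vec a) (weight_map w (int_vec a))) n%:~R].

End Polytopes.

(* The semigroup of N-linear combinations of h_1, ..., h_r *)
Definition nat_span (V : nmodType) (r : nat) (h : 'I_r -> V) : set V :=
  [set \sum_i h i *+ k i | k in [set: 'I_r -> nat]].

Section Algebras.
Variables (K : fieldType) (B : algType K).

Definition gen_subalg (G : set B) : set B :=
  smallest (fun A : set B => GRing.subalg_closed (mem A)) G.

Definition lin_span (G : set B) : set B :=
  smallest (fun A : set B => GRing.submod_closed (mem A)) G.

Definition has_dim (V : set B) (d : nat) : Prop :=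
  exists e : 'I_d -> B,
    (forall c : 'I_d -> K, \sum_i c i *: e i = 0 -> forall i, c i = 0) /\
    V = lin_span (range e).

(* A is the (internal) direct sum of the A_ n *)
Definition is_direct_sum (A : set B) (A_ : nat -> set B) : Prop :=
  (forall f, A f <-> exists (k : nat) (g : 'I_k -> B),
     (forall i : 'I_k, A_ i (g i)) /\ f = \sum_i g i) /\
  (forall (k : nat) (g : 'I_k -> B), (forall i : 'I_k, A_ i (g i)) ->
     \sum_i g i = 0 -> forall i, g i = 0).

Definition is_graded_alg (A : set B) (A_ : nat -> set B) : Prop :=
  [/\ GRing.subalg_closed (mem A),
      forall n, GRing.submod_closed (mem (A_ n)),
      is_direct_sum A A_,
      A_ 0%N 1
    & forall i j f g, A_ i f -> A_ j g -> A_ (i + j)%N (f * g)].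

End Algebras.

Definition exp_vec (n : nat) (m : 'X_{1..n}) : 'rV[int]_n := \row_i (m i)%:Z.

(* The monomials with exponent vector in S. Only exponents in N^n give elements
   of the polynomial ring: this is to be used with S included in N^n, as is the
   case for the cones of polytopes with vertices in N^n. *)
Definition monomials (K : fieldType) (n : nat) (S : set 'rV[int]_n) :
  set {mpoly K[n]} := [set 'X_[m] | m in [set m | S (exp_vec m)]].
Arguments monomials K {n} S.

Section EhrhartRings.
Variables (K : fieldType) (R : realType).

Definition monomial_subring (n : nat) (S : set 'rV[int]_n) :
  set {mpoly K[n]} := gen_subalg (monomials K S).

Definition semigroup_ring (n r : nat) (h : 'I_r -> 'rV[int]_n) :
  set {mpoly K[n]} := lin_span (monomials K (nat_span h)).

Definition ehrhart_ring (N : nat) (Q : set 'rV[R]_N) : set {mpoly K[N + 1]} :=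
  monomial_subring (lattice_pts (cone Q)).

Definition weighted_ehrhart_ring (s p : nat) (w : 'I_p -> {scalar 'rV[R]_s})
  (Q : set 'rV[R]_s) : set {mpoly K[s + p + 1]} :=
  monomial_subring (weight_exps w (lattice_pts (cone Q))).

Definition weighted_ehrhart_component (s p : nat)
  (w : 'I_p -> {scalar 'rV[R]_s}) (Q : set 'rV[R]_s) (n : nat) :
  set {mpoly K[s + p + 1]} :=
  lin_span (monomials K (weight_exps w (dilate_slice Q n))).

End EhrhartRings.
Arguments monomial_subring K {n} S.
Arguments semigroup_ring K {n r} h.
Arguments ehrhart_ring K {R N} Q.
Arguments weighted_ehrhart_ring K {R s p} w Q.
Arguments weighted_ehrhart_component K {R s p} w Q n.

(* A formal power series is given by its coefficients. *)
Definition mseries (K : fieldType) (n : nat) := 'X_{1..n} -> K.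

Definition mul_poly_series (K : fieldType) (n : nat) (g : {mpoly K[n]})
  (F : mseries K n) : mseries K n :=
  fun m => \sum_(k <- msupp g | (k <= m)%MM) g@_k * F (m - k)%MM.

(* F is the expansion at 0 of the rational function f / g *)
Definition is_rational_series (K : fieldType) (n : nat) (F : mseries K n) :
  Prop :=
  exists f g : {mpoly K[n]},
    g@_0%MM != 0 /\ forall m, mul_poly_series g F m = f@_m.

(* The coefficients are 0 or 1 because (a, n) is determined by (a, w(a), n). *)
Definition weighted_ehrhart_series (K : fieldType) (R : realType) (s p : nat)
  (w : 'I_p -> {scalar 'rV[R]_s}) (Q : set 'rV[R]_s) : mseries K (s + p + 1) :=
  fun m => (`[< weight_exps w (lattice_pts (cone Q)) (exp_vec m) >])%:R.
Arguments weighted_ehrhart_series K {R s p} w Q.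

(* Main.v *)
Require Import Defs.
From mathcomp Require Import zify.

Set Implicit Arguments.
Unset Strict Implicit.
Unset Printing Implicit Defensive.

Import Order.TTheory GRing.Theory Num.Theory.

Local Open Scope classical_set_scope.
Local Open Scope ring_scope.

(** A point of the dilate [n P], and a point at height [n] of the cone over [P],
    are both a combination of the vertices [v_i] with nonnegative coefficients
    of sum [n] ([cone_comb]).  So the lattice points of the cone are the disjoint
    union of those of the dilates ([lattice_cone_slices]); they form a monoid,
    and the algebra generated by their monomials is the linear span of these
    monomials ([monomial_subring_submonoid]).  This gives (a), and grading by the
    height gives (b), the monomials of a component being a basis of it.

    The weight [w] being linear and integral on lattice points, the lattice
    points of the cone over the lifted polytope are exactly the [(a, w(a), n)]
    with [(a, n)] in the cone over [P] ([lattice_cone_lifting]), and similarly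
    for the dilates.  Since [a |-> (a, w(a))] is injective, (c) follows.

    For (d), the monoid of lattice points is finitely generated by Gordan's
    lemma ([gordan]), and [(a, n) |-> (a, w(a), n)] is a morphism of monoids, so
    it carries generators to generators.

    For (e), by (d) the exponents of the series form a finitely generated
    submonoid of [N^k], and the indicator series of any such submonoid, generated
    by [h_1, ..., h_r], is rational ([rational_mnm_span]).  Among the ways of
    writing an element as a combination of the generators, keep the
    lexicographically least one: the set [D] of coefficient vectors kept is
    closed downwards in [N^r] and maps bijectively to the submonoid.  For any
    downward closed [D] on which the map is injective, the series is rational
    ([rational_downset]), by induction on [r]: slice [D] along its first
    coordinate.  The slices decrease, hence are eventually constant
    ([downset_stationary], a form of Dickson's lemma), so that the series is a
    finite sum of shifted series of slices plus a geometric tail with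
    denominator [1 - x^{h_1}]. *)

(** * Spans of monomials *)

Lemma exp_vec_inj n : injective (@exp_vec n).
Proof.
move=> a b /rowP e; apply/mnmP => i.
by have := e i; rewrite !mxE => -[].
Qed.

Lemma exp_vecD n (a b : 'X_{1..n}) : exp_vec (a + b)%MM = exp_vec a + exp_vec b.
Proof. by apply/rowP => i; rewrite !mxE mnmDE PoszD. Qed.

Lemma exp_vec0 n : exp_vec (0%MM : 'X_{1..n}) = 0.
Proof. by apply/rowP => i; rewrite !mxE mnm0E. Qed.

Lemma exp_vecMn n (a : 'X_{1..n}) k : exp_vec (a *+ k)%MM = exp_vec a *+ k.
Proof.
elim: k => [|k IH]; first by rewrite mulm0n exp_vec0.
by rewrite mulmS exp_vecD IH mulrS.
Qed.

(** Meant for vectors with nonnegative entries: the signs are lost. *)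
Definition mnm_of n (u : 'rV[int]_n) : 'X_{1..n} :=
  [multinom absz (u 0%R j) | j < n].

Lemma mnm_ofK n (u : 'rV[int]_n) : (forall j, 0 <= u 0 j) -> exp_vec (mnm_of u) = u.
Proof. by move=> u0; apply/rowP => j; rewrite !mxE mnmE gez0_abs. Qed.

Section Supports.
Variables (K : fieldType) (n : nat).
Implicit Types (S : set 'rV[int]_n) (f : {mpoly K[n]}).

(** The linear span of the monomials with exponents in [S], in a form where
    membership is decided monomial by monomial. *)
Definition supported S : set {mpoly K[n]} :=
  [set f | forall a, a \in msupp f -> S (exp_vec a)].

Lemma supportedX S a : S (exp_vec a) -> supported S 'X_[a].
Proof. by move=> Sa b; rewrite msuppX inE => /eqP->. Qed.

Lemma supported_coef0 S f a : supported S f -> ~ S (exp_vec a) -> f@_a = 0.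
Proof. by move=> Sf nSa; apply/memN_msupp_eq0/negP => /Sf. Qed.

Lemma supported_submod S : GRing.submod_closed (mem (supported S)).
Proof.
split; first by rewrite mem_set // => a; rewrite msupp0.
move=> c f g; rewrite !inE => Sf Sg a /msuppD_le.
by rewrite mem_cat => /orP[/msuppZ_le|]; [apply: Sf | apply: Sg].
Qed.

Lemma submod_sum (A : set {mpoly K[n]}) (I : Type) (r : seq I) (c : I -> K)
    (F : I -> {mpoly K[n]}) :
  GRing.submod_closed (mem A) -> (forall i, A (F i)) ->
  A (\sum_(i <- r) c i *: F i).
Proof.
move=> [A0 Alin] AF; elim: r => [|i r IH].
  by rewrite big_nil; move: A0; rewrite inE.
rewrite big_cons; have := Alin (c i) (F i) (\sum_(j <- r) c j *: F j).
by rewrite !inE; apply.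
Qed.

(** A polynomial is the linear combination of its own monomials. *)
Lemma submod_supported (A : set {mpoly K[n]}) S :
  GRing.submod_closed (mem A) -> monomials K S `<=` A -> supported S `<=` A.
Proof.
move=> Asub SA f Sf; rewrite [f]mpolyE big_seq_cond.
(* In submod_sum all summands must be in A, so the monomials outside
   the support are replaced by 0 first. *)
rewrite (eq_bigr (fun a => f@_a *: (if a \in msupp f then 'X_[a] else 0))).
  rewrite -big_seq_cond; apply: submod_sum => // a.
  case: ifP => [/Sf Sa|_]; first by apply: SA; exists a.
  by case: Asub; rewrite inE.
by move=> a /andP[-> _].
Qed.

Lemma lin_span_monomials S : lin_span (monomials K S) = supported S.
Proof.
apply/seteqP; split.
  apply: smallest_sub; first exact: supported_submod.
  by move=> _ [a Sa <-]; apply: supportedX.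
move=> f Sf A [Asub SA]; exact: (submod_supported Asub SA Sf).
Qed.

Lemma supported_subalg S : S 0 -> (forall a b, S a -> S b -> S (a + b)) ->
  GRing.subalg_closed (mem (supported S)).
Proof.
move=> S0 SD; split; last 2 first.
- by case: (supported_submod S).
- move=> f g; rewrite !inE => Sf Sg a /msuppM_le /allpairsP[[b c] /= [bf cg ->]].
  by rewrite exp_vecD; apply: SD; [apply: Sf | apply: Sg].
by rewrite inE -mpolyX0; apply: supportedX; rewrite exp_vec0.
Qed.

(** Products of monomials of [S] being monomials of [S], no further monomial
    arises when generating an algebra instead of a linear span. *)
Lemma monomial_subring_submonoid S :
  S 0 -> (forall a b, S a -> S b -> S (a + b)) ->
  monomial_subring K S = supported S.
Proof.
move=> S0 SD; apply/seteqP; split.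
  apply: smallest_sub; first exact: supported_subalg.
  by move=> _ [a Sa <-]; apply: supportedX.
move=> f Sf A [Asub SA]; apply: (submod_supported _ SA Sf).
exact: GRing.subalg_closedZ.
Qed.

End Supports.
Arguments supported K {n} S.

Lemma nat_span0 (V : nmodType) r (h : 'I_r -> V) : nat_span h 0.
Proof. by exists (fun=> 0%N) => //; rewrite big1 // => i _; rewrite mulr0n. Qed.

Lemma nat_spanD (V : nmodType) r (h : 'I_r -> V) a b :
  nat_span h a -> nat_span h b -> nat_span h (a + b).
Proof.
move=> [k _ <-] [l _ <-]; exists (fun i => (k i + l i)%N) => //.
by rewrite -big_split; apply: eq_bigr => i _; rewrite mulrnDr.
Qed.

Lemma sub_nat_span (V : nmodType) r (h : 'I_r -> V) : range h `<=` nat_span h.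
Proof.
move=> _ [i _ <-]; exists (fun j => (j == i)%N) => //.
by rewrite (bigD1 i) //= eqxx big1 ?addr0 // => j /negPf->.
Qed.

Lemma sub_nat_span_monoid (V : nmodType) r (h : 'I_r -> V) (S : set V) :
  S 0 -> (forall a b, S a -> S b -> S (a + b)) -> (forall i, S (h i)) ->
  nat_span h `<=` S.
Proof.
move=> S0 SD Sh _ [k _ <-]; apply: big_ind => // i _.
by elim: (k i) => [|l IH]; rewrite ?mulr0n // mulrS; apply: SD.
Qed.

(** The monomial of a combination of the [h i] is a product of powers of the
    monomials of the [h i], so both sets generate the same algebra. *)
Lemma monomial_subring_nat_span (K : fieldType) n r (h : 'I_r -> 'X_{1..n}) :
  monomial_subring K (range (fun i => exp_vec (h i))) =
  monomial_subring K (nat_span (fun i => exp_vec (h i))).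
Proof.
apply/seteqP; split; apply: smallest_sub.
- rewrite monomial_subring_submonoid;
    [apply: supported_subalg | |]; (exact: nat_span0 || exact: nat_spanD).
- move=> _ [a ha <-] A [Asub SA]; apply: SA; exists a => //.
  exact: sub_nat_span.
- split; first by rewrite inE => A [[+ _ _] _]; rewrite inE.
    move=> c f g; rewrite !inE => Sf Sg A hA; case: (hA) => -[_ Alin _] _.
    by have := Alin c f g; rewrite !inE; apply; [apply: Sf | apply: Sg].
  move=> f g; rewrite !inE => Sf Sg A hA; case: (hA) => -[_ _ AM] _.
  by have := AM f g; rewrite !inE; apply; [apply: Sf | apply: Sg].
move=> _ [a [k _ ka] <-] A [[A1 _ AM] hA].
have -> : a = (\sum_i h i *+ k i)%MM.
  apply: exp_vec_inj; rewrite -ka.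
  rewrite (big_morph _ (@exp_vecD n) (@exp_vec0 n)).
  by apply: eq_bigr => i _; rewrite exp_vecMn.
rewrite -mprodXnE -in_setE; apply: (big_ind (fun f => f \in A)) => //.
move=> i _; elim: (k i) => [|l IH]; first by rewrite expr0.
rewrite exprS; apply: AM => //; rewrite inE; apply: hA.
by exists (h i) => //; exists i.
Qed.

(** Sorting the terms of a polynomial by the degree of their exponent, which
    the last hypothesis makes unique, splits it into homogeneous components. *)
Lemma supported_graded (K : fieldType) n (S : nat -> set 'rV[int]_n) :
  S 0%N 0 -> (forall i j a b, S i a -> S j b -> S (i + j)%N (a + b)) ->
  (forall i j a, S i a -> S j a -> i = j) ->
  is_graded_alg (supported K (\bigcup_i S i)) (fun i => supported K (S i)).
Proof.
move=> S0 SD Sinj.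
pose U := \bigcup_i S i.
have U0 : U 0 by exists 0%N.
have UD a b : U a -> U b -> U (a + b).
  by move=> [i _ Sa] [j _ Sb]; exists (i + j)%N => //; exact: SD.
split.
- exact: supported_subalg.
- by move=> i; exact: supported_submod.
- split=> [f|k g Sg g0 i]; first split.
  + move=> Uf.
    have [d dP] : exists d : 'X_{1..n} -> nat,
        forall a, a \in msupp f -> S (d a) (exp_vec a).
      suff /choice[d dP] : forall a, exists i, a \in msupp f -> S i (exp_vec a).
        by exists d.
      move=> a; case: (boolP (a \in msupp f)) => [/Uf[i _ Sa]|_]; last by exists 0%N.
      by exists i.
    exists (\max_(a <- msupp f) d a).+1.
    exists (fun i : 'I__ => \sum_(a <- msupp f | d a == i :> nat) f@_a *: 'X_[a]); split.
      move=> i a; rewrite mcoeff_msupp raddf_sum /= => /eqP nz.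
      apply: contrapT => nSa; apply: nz; rewrite big_seq_cond big1 // => b.
      move=> /andP[bf /eqP db]; rewrite mcoeffZ mcoeffX; case: eqP => [ba|_].
        by case: nSa; rewrite -ba -db; exact: dP.
      by rewrite mulr0.
    rewrite {1}[f]mpolyE (exchange_big_dep xpredT) //=.
    rewrite big_seq [RHS]big_seq; apply: eq_bigr => a af.
    have da : (d a < (\max_(a <- msupp f) d a).+1)%N.
      by rewrite ltnS; exact: leq_bigmax_seq.
    by rewrite (big_pred1 (Ordinal da)).
  + move=> [k [g [Sg ->]]] a; rewrite mcoeff_msupp raddf_sum /= => /eqP nz.
    apply: contrapT => nUa; apply: nz; rewrite big1 // => i _.
    by apply: supported_coef0 (Sg i) _ => Sa; apply: nUa; exists i.
  + apply/mpolyP => a; rewrite mcoeff0.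
    case: (pselect (S i (exp_vec a))) => [Sa|nSa]; last exact: supported_coef0 nSa.
    move/(congr1 (mcoeff a)): g0.
    rewrite raddf_sum mcoeff0 (bigD1 i) //= big1 ?addr0 // => j ji.
    apply: supported_coef0 (Sg j) _ => Sja.
    by move: ji; rewrite -(inj_eq val_inj) /= (Sinj _ _ _ Sja Sa) eqxx.
- by rewrite -mpolyX0; apply: supportedX; rewrite exp_vec0.
move=> i j f g Sf Sg a /msuppM_le /allpairsP[[b c] /= [bf cg ->]].
by rewrite exp_vecD; apply: SD; [apply: Sf | apply: Sg].
Qed.

(** The monomials with exponent in [S] form a basis. *)
Lemma has_dim_supported (K : fieldType) n (S : set 'rV[int]_n) :
  finite_set S -> (forall u, S u -> forall j, 0 <= u 0 j) ->
  has_dim (supported K S) #|` fset_set S|.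
Proof.
move=> fS S0; pose u (i : 'I_(#|` fset_set S|)) := nth 0 (fset_set S) i.
have Su i : S (u i).
  by rewrite -in_setE -in_fset_set //; apply: mem_nth.
exists (fun i => 'X_[mnm_of (u i)]); split.
  move=> c c0 i; move/(congr1 (mcoeff (mnm_of (u i)))): c0.
  rewrite raddf_sum mcoeff0 (bigD1 i) //= mcoeffZ mcoeffX eqxx mulr1.
  rewrite big1 ?addr0 // => j ji; rewrite mcoeffZ mcoeffX.
  case: eqP => [/(congr1 (@exp_vec n))|]; last by rewrite mulr0.
  rewrite !mnm_ofK; try by apply: S0.
  move=> /eqP; rewrite nth_uniq ?fset_uniq // => /eqP/val_inj ij.
  by rewrite ij eqxx in ji.
rewrite -lin_span_monomials; congr lin_span; apply/seteqP; split.
  move=> _ [a Sa <-].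
  have aS : exp_vec a \in (fset_set S : seq _).
    by rewrite in_fset_set // inE.
  have ia : (index (exp_vec a) (fset_set S) < #|` fset_set S|)%N by rewrite index_mem.
  exists (Ordinal ia) => //; congr mpolyX; apply: exp_vec_inj.
  by rewrite mnm_ofK; [rewrite /u nth_index | exact: S0 (Su _)].
move=> _ [i _ <-]; exists (mnm_of (u i)) => //.
by rewrite /= mnm_ofK //; exact: S0.
Qed.

(** * Lattice points of the cone over a lattice polytope *)

Lemma with_height_sum (A : pzRingType) N (I : Type) (r : seq I) (l c : I -> A)
    (x : I -> 'rV[A]_N) :
  \sum_(i <- r) l i *: with_height (x i) (c i) =
  with_height (\sum_(i <- r) l i *: x i) (\sum_(i <- r) l i * c i).
Proof.
elim/big_rec3: _ => [|i y1 y2 y3 _ ->].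
  by apply/rowP => j; rewrite !mxE; case: splitP => k _; rewrite !mxE.
by rewrite /with_height scale_row_mx add_row_mx; congr row_mx; apply/rowP => j;
  rewrite !mxE.
Qed.

Lemma with_height_inj (T : Type) N (a b : 'rV[T]_N) (n k : T) :
  with_height a n = with_height b k -> a = b /\ n = k.
Proof. by move/eq_row_mx => [-> /rowP/(_ 0)]; rewrite !mxE. Qed.

Lemma with_heightP (T : Type) N (u : 'rV[T]_(N + 1)) :
  exists a n, u = with_height a n.
Proof.
exists (lsubmx u), (rsubmx u 0 0); rewrite -[LHS]hsubmxK; congr row_mx.
by apply/rowP => j; rewrite ord1 !mxE.
Qed.

Lemma with_heightD (V : nmodType) N (a b : 'rV[V]_N) (n k : V) :
  with_height a n + with_height b k = with_height (a + b) (n + k).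
Proof.
rewrite /with_height add_row_mx; congr row_mx.
by apply/rowP => j; rewrite !mxE.
Qed.

Lemma with_height0 (V : nmodType) N : with_height 0 0 = 0 :> 'rV[V]_(N + 1).
Proof. by apply/rowP => j; rewrite !mxE; case: splitP => i _; rewrite !mxE. Qed.

Section IntVec.
Variables (R : realType) (N : nat).
Local Notation iv := (@int_vec R _).

Lemma int_vec_inj : injective (@int_vec R N).
Proof.
move=> a b /rowP e; apply/rowP => j.
by have := e j; rewrite !mxE => /intr_inj.
Qed.

Lemma int_vec_with_height (a : 'rV[int]_N) n :
  iv (with_height a n) = with_height (iv a) n%:~R.
Proof. by rewrite /int_vec map_row_mx map_const_mx. Qed.

Lemma int_vecD (a b : 'rV[int]_N) : iv (a + b) = iv a + iv b.
Proof. exact: map_mxD. Qed.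

Lemma int_vec_sum_nat (I : finType) (t : I -> nat) (x : I -> 'rV[int]_N) :
  iv (\sum_i x i *+ t i) = \sum_i (t i)%:R *: iv (x i).
Proof.
rewrite /int_vec map_mx_sum; apply: eq_bigr => i _.
by rewrite raddfMn scaler_nat.
Qed.

End IntVec.

Section LatticePolytope.
Variables (R : realType) (m N : nat) (v : 'I_m -> 'rV[int]_N).
Hypothesis m_gt0 : (0 < m)%N.
Local Notation iv := (@int_vec R _).
Local Notation P := (conv_hull (fun i => iv (v i))).

(** The points [(x, t)] of the real cone over the polytope, described by
    combinations of the vertices alone.  The height [t] is the sum of the
    coefficients, so this describes at once the dilates (at [t = n]) and the cone. *)
Definition cone_comb (x : 'rV[R]_N) (t : R) : Prop :=
  exists l : 'I_m -> R,
    [/\ forall i, 0 <= l i, \sum_i l i = t & x = \sum_i l i *: iv (v i)].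

Lemma cone_combD x y t u :
  cone_comb x t -> cone_comb y u -> cone_comb (x + y) (t + u).
Proof.
move=> [l [l0 <- ->]] [k [k0 <- ->]]; exists (fun i => l i + k i); split.
- by move=> i; rewrite addr_ge0.
- by rewrite big_split.
- by rewrite -big_split; apply: eq_bigr => i _; rewrite scalerDl.
Qed.

Lemma cone_combZ c x t : 0 <= c -> cone_comb x t -> cone_comb (c *: x) (c * t).
Proof.
move=> c0 [l [l0 <- ->]]; exists (fun i => c * l i); split.
- by move=> i; rewrite mulr_ge0.
- by rewrite mulr_sumr.
- by rewrite scaler_sumr; apply: eq_bigr => i _; rewrite scalerA.
Qed.

Lemma cone_comb0 : cone_comb 0 0.
Proof.
by exists (fun=> 0); split; rewrite ?big1 // => i _; rewrite scale0r.
Qed.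

Lemma cone_comb_ge0 x t : cone_comb x t -> 0 <= t.
Proof. by move=> [l [l0 <- _]]; apply: sumr_ge0. Qed.

Lemma cone_comb_height0 x : cone_comb x 0 -> x = 0.
Proof.
move=> [l [l0 l1 ->]]; apply: big1 => i _.
have /psumr_eq0P/(_ l1 i) -> // : forall i, true -> 0 <= l i by move=> j _; exact: l0.
by rewrite scale0r.
Qed.

Lemma cone_comb_vertex i : cone_comb (iv (v i)) 1.
Proof.
exists (fun j => (j == i)%:R); split=> [j||]; first exact: ler0n.
  by rewrite (bigD1 i) //= eqxx big1 ?addr0 // => j /negPf->.
rewrite (bigD1 i) //= eqxx scale1r big1 ?addr0 // => j /negPf->.
by rewrite scale0r.
Qed.

(** For [n > 0], divide the coefficients by [n].  For [n = 0] all coefficients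
    vanish and [x = 0], which is [0 *: y] for any [y] of the polytope: this is
    where there must be at least one vertex. *)
Lemma dilate_conv_hull n x : dilate n P x <-> cone_comb x n%:R.
Proof.
split=> [[y Py <-]|].
  by rewrite -[X in cone_comb _ X]mulr1; apply: cone_combZ.
case: n => [|n] xn.
  exists (iv (v (Ordinal m_gt0))); first exact: cone_comb_vertex.
  by rewrite scale0r (cone_comb_height0 xn).
exists (n.+1%:R^-1 *: x); last by rewrite scalerA divff ?scale1r ?pnatr_eq0.
have := @cone_combZ n.+1%:R^-1 _ _ _ xn.
by rewrite invr_ge0 ler0n mulVf ?pnatr_eq0 //; apply.
Qed.

(** The cone is generated by all the lattice points of the polytope at height
    one; each of them is a combination of the vertices, which are themselves
    lattice points, so the vertices generate the same cone. *)
Lemma cone_conv_hull x t : cone P (with_height x t) <-> cone_comb x t.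
Proof.
split=> [[k [g [l [Pg l0 xt]]]]|[l [l0 lt ->]]].
  have /choice[a aP] : forall i, exists a, P (iv a) /\ with_height (iv a) 1 = g i.
    by move=> i; case: (Pg i) => a Pa ag; exists a.
  move: xt; under eq_bigr do rewrite -(aP _).2.
  rewrite with_height_sum => xt; have [-> ->] := with_height_inj xt.
  apply: (big_ind2 cone_comb) => [||i _]; first exact: cone_comb0.
    by move=> x1 t1 x2 t2; exact: cone_combD.
  by apply: cone_combZ; [exact: l0 | exact: (aP i).1].
exists m, (fun i => with_height (iv (v i)) 1), l; split=> //.
  by move=> i; exists (v i) => //; exact: cone_comb_vertex.
rewrite with_height_sum -lt; congr with_height.
by apply: eq_bigr => i _; rewrite mulr1.
Qed.

Lemma lattice_coneE a n :
  lattice_pts (cone P) (with_height a n) <-> cone_comb (iv a) n%:~R.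
Proof. by rewrite /lattice_pts /= int_vec_with_height; exact: cone_conv_hull. Qed.

Lemma dilate_sliceE k a n :
  dilate_slice P k (with_height a n) <-> cone_comb (iv a) n%:~R /\ n = k%:Z.
Proof.
split=> [[b kb e]|[an nk]].
  have [<- <-] := with_height_inj e.
  by split=> //; exact/dilate_conv_hull.
by exists a; [apply/dilate_conv_hull; rewrite nk in an | rewrite nk].
Qed.

(** Dividing by the height identifies the section of the cone at height [n]
    with the [n]-th dilate; at height zero both are reduced to the origin. *)
Lemma lattice_cone_slices :
  lattice_pts (cone P) = \bigcup_n dilate_slice P n.
Proof.
apply/seteqP; split=> u; case: (with_heightP u) => a [n ->].
  move=> /lattice_coneE an; exists `|n|%N => //; apply/dilate_sliceE; split=> //.
  by rewrite gez0_abs // -(ler0z R) (cone_comb_ge0 an).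
by move=> [k _ /dilate_sliceE[an _]]; apply/lattice_coneE.
Qed.

Lemma lattice_cone0 : lattice_pts (cone P) 0.
Proof.
by rewrite -with_height0; apply/lattice_coneE; rewrite /int_vec map_mx0; exact: cone_comb0.
Qed.

Lemma lattice_coneD a b :
  lattice_pts (cone P) a -> lattice_pts (cone P) b -> lattice_pts (cone P) (a + b).
Proof.
case: (with_heightP a) (with_heightP b) => [a' [n ->]] [b' [k ->]].
rewrite with_heightD => /lattice_coneE an /lattice_coneE bk.
by apply/lattice_coneE; rewrite int_vecD intrD; exact: cone_combD.
Qed.

Lemma dilate_slice0 : dilate_slice P 0 0.
Proof.
rewrite -with_height0; apply/dilate_sliceE; split=> //.
by rewrite /int_vec map_mx0; exact: cone_comb0.
Qed.

Lemma dilate_sliceD i j a b :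
  dilate_slice P i a -> dilate_slice P j b -> dilate_slice P (i + j) (a + b).
Proof.
case: (with_heightP a) (with_heightP b) => [a' [k ->]] [b' [l ->]].
rewrite with_heightD => /dilate_sliceE[ak ki] /dilate_sliceE[bl lj].
apply/dilate_sliceE; split; last by rewrite ki lj PoszD.
by rewrite int_vecD intrD; exact: cone_combD.
Qed.

Lemma dilate_slice_height i j a : dilate_slice P i a -> dilate_slice P j a -> i = j.
Proof.
by case: (with_heightP a) => [a' [k ->]] /dilate_sliceE[_ ->] /dilate_sliceE[_ []].
Qed.

Lemma finite_bounded_vec (B : nat) :
  finite_set [set a : 'rV[int]_N | forall j, `|a 0 j| <= B%:Z].
Proof.
pose f (k : 'rV['I_(B + B).+1]_N) : 'rV[int]_N := map_mx (fun i : 'I__ => i%:Z - B%:Z) k.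
apply: (@sub_finite_set _ _ (range f)); last exact/finite_image/finite_finset.
move=> a aB; exists (\row_j inord (absz (a 0 j + B%:Z))) => //.
apply/rowP => j; rewrite !mxE; have := aB j => {}aB.
rewrite inordK; lia.
Qed.

(** A coefficient is at most the sum [n] of all of them, which bounds the entries. *)
Lemma finite_dilate n : finite_set (lattice_pts (dilate n P)).
Proof.
pose B := (\sum_i \sum_j n * absz (v i 0%R j))%N.
apply: sub_finite_set (finite_bounded_vec B) => a /dilate_conv_hull[l [l0 ln /rowP al]] j.
rewrite -(ler_int R) intr_norm; have := al j; rewrite !mxE summxE => ->.
apply: le_trans (ler_norm_sum _ _ _) _.
rewrite /B -pmulrn natr_sum; apply: ler_sum => i _.
rewrite natr_sum (bigD1 j) //= -[leLHS]addr0 lerD ?sumr_ge0 //.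
rewrite !mxE normrM natrM -intr_norm natr_absz ler_wpM2r ?ler0z //.
rewrite ger0_norm // -ln (bigD1 i) //= lerDl; exact: sumr_ge0.
Qed.

Lemma finite_dilate_slice n : finite_set (dilate_slice P n).
Proof. exact/finite_image/finite_dilate. Qed.

(** Gordan's lemma.  If [(a, n)] is a combination of the [(v i, 1)] with
    coefficients [l i], subtracting the combination with the integer parts of
    the [l i] leaves a lattice point of the cone of height less than [m]; the
    lattice points of height at most [m] are finite in number and include the
    [(v i, 1)]. *)
Lemma gordan : exists r (h : 'I_r -> 'rV[int]_(N + 1)),
  lattice_pts (cone P) = nat_span h.
Proof.
pose H := \bigcup_(n in `I_m.+1) dilate_slice P n.
have fH : finite_set H.
  by apply: bigcup_finite => [|n _]; [exact: finite_II | exact: finite_dilate_slice].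
pose h (i : 'I_(#|` fset_set H|)) := nth 0 (fset_set H) i.
have Hh u : H u -> nat_span h u.
  move=> Hu; apply: sub_nat_span.
  have uH : u \in (fset_set H : seq _) by rewrite in_fset_set // inE.
  have iu : (index u (fset_set H) < #|` fset_set H|)%N by rewrite index_mem.
  by exists (Ordinal iu) => //; rewrite /h nth_index.
exists _, h; apply/seteqP; split; last first.
  apply: sub_nat_span_monoid; [exact: lattice_cone0 | exact: lattice_coneD |].
  move=> i; have : H (h i) by rewrite -in_setE -in_fset_set //; apply: mem_nth.
  by rewrite lattice_cone_slices => -[n _ ?]; exists n.
move=> u; case: (with_heightP u) => a [n ->] /lattice_coneE[l [l0 ln al]].
pose t i := Num.truncn (l i).
have tl i : (t i)%:R <= l i < (t i).+1%:R by apply: truncn_itv.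
pose b := a - \sum_i v i *+ t i; pose k := n - (\sum_i t i)%N%:Z.
have bE : iv b = \sum_i (l i - (t i)%:R) *: iv (v i).
  rewrite /b /int_vec raddfB /= -!/(int_vec _ _) int_vec_sum_nat al -sumrB.
  by apply: eq_bigr => i _; rewrite scalerBl.
have kE : k%:~R = \sum_i (l i - (t i)%:R) :> R.
  by rewrite /k intrB -ln sumrB; congr (_ - _); rewrite -pmulrn natr_sum.
have bk : cone_comb (iv b) k%:~R.
  exists (fun i => l i - (t i)%:R); split=> // i.
  by rewrite subr_ge0; case/andP: (tl i).
have k0 : 0 <= k by rewrite -(ler0z R) (cone_comb_ge0 bk).
have km : k <= m%:Z.
  rewrite -(ler_int R) kE -[m in leRHS]card_ord -sum1_card -pmulrn natr_sum.
  apply: ler_sum => i _; rewrite lerBlDl natr1.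
  by case/andP: (tl i) => _ /ltW.
have -> : with_height a n = with_height b k + \sum_i with_height (v i) 1 *+ t i.
  under eq_bigr do rewrite -scaler_nat.
  rewrite with_height_sum with_heightD; congr with_height.
    rewrite -[LHS](subrK (\sum_i v i *+ t i)); congr (_ + _).
    by apply: eq_bigr => i _; rewrite scaler_nat.
  rewrite -[LHS](subrK (\sum_i t i)%N%:Z); congr (_ + _).
  by rewrite -natz natr_sum; apply: eq_bigr => i _; rewrite mulr1.
apply: nat_spanD.
  apply: Hh; exists `|k|%N; first by rewrite /=; lia.
  by apply/dilate_sliceE; split=> //; lia.
apply: big_ind => [||i _]; [exact: nat_span0 | exact: nat_spanD |].
elim: (t i) => [|j IH]; first by rewrite mulr0n; exact: nat_span0.
rewrite mulrS; apply: nat_spanD => //; apply: Hh; exists 1%N.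
  by rewrite /= ltnS.
by apply/dilate_sliceE; split=> //; exact: cone_comb_vertex.
Qed.

End LatticePolytope.

(** * The lifting [(a, n) |-> (a, w(a), n)] *)

(** The weights are nonnegative integers on the unit vectors, hence given by an
    integer matrix. *)
Lemma weight_matrix (R : realType) s p (w : 'I_p -> {scalar 'rV[R]_s}) :
  (forall i j, w i (delta_mx 0 j) \is a Num.nat) ->
  exists W : 'M[int]_(s, p), (forall j i, 0 <= W j i) /\
    forall x, weight_map w x = x *m map_mx intr W.
Proof.
move=> hw; exists (\matrix_(j, i) (Num.truncn (w i (delta_mx 0 j)))%:Z).
split=> [j i|x]; first by rewrite mxE.
apply/rowP => i; rewrite !mxE {1}[x]row_sum_delta linear_sum.
apply: eq_bigr => j _; rewrite linearZ !mxE -pmulrn truncnK //.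
Qed.

Section Lift.
Variables (R : realType) (s p : nat) (w : 'I_p -> {scalar 'rV[R]_s}).
Variable W : 'M[int]_(s, p).
Hypothesis wE : forall x, weight_map w x = x *m map_mx intr W.
Local Notation iv := (@int_vec R _).

Definition graph (a : 'rV[int]_s) : 'rV[int]_(s + p) := row_mx a (a *m W).

Definition lift (u : 'rV[int]_(s + 1)) : 'rV[int]_(s + p + 1) :=
  with_height (graph (lsubmx u)) (rsubmx u 0 0).

Lemma lift_with_height a n : lift (with_height a n) = with_height (graph a) n.
Proof. by rewrite /lift row_mxKl row_mxKr mxE. Qed.

Lemma graph_inj : injective graph.
Proof. by move=> a b /eq_row_mx[]. Qed.

Lemma lift_inj : injective lift.
Proof.
move=> u u'; case: (with_heightP u) (with_heightP u') => [a [n ->]] [b [k ->]].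
rewrite !lift_with_height => e; have [gab <-] := with_height_inj e.
by rewrite (graph_inj gab).
Qed.

Lemma lift0 : lift 0 = 0.
Proof.
rewrite /lift /graph !linear0 mul0mx row_mx0 mxE.
exact: with_height0.
Qed.

Lemma liftD : {morph lift : u u' / u + u'}.
Proof.
move=> u u'; case: (with_heightP u) (with_heightP u') => [a [n ->]] [b [k ->]].
rewrite with_heightD !lift_with_height with_heightD.
by rewrite /graph add_row_mx mulmxDl.
Qed.

Lemma liftMn k : {morph lift : u / u *+ k}.
Proof.
by move=> u; elim: k => [|k IH]; rewrite ?mulr0n ?lift0 // !mulrS liftD IH.
Qed.

Lemma int_vec_graph a : iv (graph a) = row_mx (iv a) (weight_map w (iv a)).
Proof. by rewrite wE /int_vec map_row_mx map_mxM. Qed.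

Lemma weight_exps_lift S : weight_exps w S = lift @` S.
Proof.
apply/seteqP; split=> [u [a [n [Sa un]]]|_ [u Su <-]].
  exists (with_height a n) => //; apply: (@int_vec_inj R).
  by rewrite lift_with_height int_vec_with_height int_vec_graph un.
case: (with_heightP u) Su => a [n ->] Sa; exists a, n; split=> //.
by rewrite lift_with_height int_vec_with_height int_vec_graph.
Qed.

Lemma lift_nat_span r (h : 'I_r -> 'rV[int]_(s + 1)) :
  lift @` nat_span h = nat_span (fun i => lift (h i)).
Proof.
have E k : lift (\sum_i h i *+ k i) = \sum_i lift (h i) *+ k i.
  by rewrite (big_morph _ liftD lift0); apply: eq_bigr => i _; rewrite liftMn.
apply/seteqP; split=> [_ [_ [k _ <-] <-]|_ [k _ <-]].
  by exists k => //; rewrite E.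
by exists (\sum_i h i *+ k i); [exists k | exact: E].
Qed.

Variables (m : nat) (v : 'I_m -> 'rV[int]_s).
Hypothesis m_gt0 : (0 < m)%N.
Local Notation P := (conv_hull (fun i => iv (v i))).
Local Notation Pw := (lifting_polytope (fun i => iv (v i)) w).

Lemma lifting_polytopeE : Pw = conv_hull (fun i => iv (graph (v i))).
Proof. by congr conv_hull; apply: funext => i; rewrite int_vec_graph. Qed.

(** A linear map commutes with taking combinations, so the cone over the lifted
    polytope is the graph of [w] over the cone over the polytope. *)
Lemma cone_comb_graph y t : cone_comb (fun i => graph (v i)) y t <->
  exists2 x : 'rV[R]_s, cone_comb v x t & y = row_mx x (weight_map w x).
Proof.
have E (l : 'I_m -> R) : \sum_i l i *: iv (graph (v i)) =
    row_mx (\sum_i l i *: iv (v i)) (weight_map w (\sum_i l i *: iv (v i))).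
  rewrite wE mulmx_suml; under [X in row_mx _ X]eq_bigr do rewrite -scalemxAl.
  elim/big_rec3: _ => [|i y1 y2 y3 _ ->]; first by rewrite row_mx0.
  by rewrite int_vec_graph wE scale_row_mx add_row_mx.
split=> [[l [l0 lt ->]]|[_ [l [l0 lt ->]] ->]].
  by exists (\sum_i l i *: iv (v i)) => //; exists l.
by exists l.
Qed.

Lemma cone_comb_int_graph u t : cone_comb (fun i => graph (v i)) (iv u) t <->
  exists2 a : 'rV[int]_s, cone_comb v (iv a) t & u = graph a.
Proof.
rewrite cone_comb_graph; split=> [[x xt ux]|[a at_ ->]]; last first.
  by exists (iv a); rewrite ?int_vec_graph.
have xE : x = iv (lsubmx u).
  by rewrite /int_vec map_lsubmx -/(int_vec R _) ux row_mxKl.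
exists (lsubmx u); first by rewrite -xE.
by apply: (@int_vec_inj R); rewrite int_vec_graph -xE.
Qed.

Lemma lattice_cone_lifting :
  lattice_pts (cone Pw) = lift @` lattice_pts (cone P).
Proof.
rewrite lifting_polytopeE; apply/seteqP; split=> [u|_ [u Su <-]].
  case: (with_heightP u) => b [n ->] /lattice_coneE /cone_comb_int_graph[a an ->].
  by exists (with_height a n); [apply/lattice_coneE | rewrite lift_with_height].
case: (with_heightP u) Su => a [n ->] /lattice_coneE an.
by rewrite lift_with_height; apply/lattice_coneE/cone_comb_int_graph; exists a.
Qed.

Lemma lattice_dilate_lifting n :
  lattice_pts (dilate n Pw) = graph @` lattice_pts (dilate n P).
Proof.
rewrite lifting_polytopeE; apply/seteqP; split=> [u|_ [a /(dilate_conv_hull _ m_gt0) an <-]].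
  move=> /(dilate_conv_hull _ m_gt0) /cone_comb_int_graph[a an ->].
  by exists a => //; apply/dilate_conv_hull.
by apply/(dilate_conv_hull _ m_gt0)/cone_comb_int_graph; exists a.
Qed.

Lemma ehrhart_lifting n : ehrhart P n = ehrhart Pw n.
Proof.
rewrite /ehrhart lattice_dilate_lifting fset_set_image; last exact: finite_dilate.
by rewrite card_imfset //; exact: graph_inj.
Qed.

Hypotheses (v0 : forall i j, 0 <= v i 0 j) (W0 : forall j i, 0 <= W j i).

Lemma lattice_cone_ge0 (u : 'rV[int]_(s + 1)) :
  lattice_pts (cone P) u -> forall j, 0 <= u 0 j.
Proof.
case: (with_heightP u) => a [n ->] /lattice_coneE an j.
rewrite mxE; case: splitP => k _; last first.
  by rewrite mxE -(ler0z R) (cone_comb_ge0 an).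
case: an => l [l0 _ /rowP/(_ k)]; rewrite !mxE summxE => ak.
rewrite -(ler0z R) ak sumr_ge0 // => i _.
by rewrite !mxE mulr_ge0 // ler0z.
Qed.

Lemma lift_ge0 (u : 'rV[int]_(s + 1)) :
  (forall j, 0 <= u 0 j) -> forall j, 0 <= lift u 0 j.
Proof.
case: (with_heightP u) => a [n ->] u0 j.
have a0 i : 0 <= a 0 i by have := u0 (lshift 1 i); rewrite row_mxEl.
have n0 : 0 <= n by have := u0 (rshift s ord0); rewrite row_mxEr mxE.
rewrite lift_with_height mxE; case: splitP => k _; last by rewrite mxE.
rewrite mxE; case: splitP => i _ //.
by rewrite mxE sumr_ge0 // => l _; rewrite mulr_ge0.
Qed.

End Lift.

(** * The action of polynomials on power series *)

Section RationalSeries.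
Variables (K : fieldType) (n : nat).
Implicit Types (g q : {mpoly K[n]}) (F G : mseries K n) (a b : 'X_{1..n}).

Lemma mcoeffXM a q b :
  ('X_[a] * q)@_b = if (a <= b)%MM then q@_(b - a) else 0.
Proof.
case: ifP => [ab|nab].
  by rewrite -{1}(submK ab) addmC mulrC mcoeffMX.
apply/memN_msupp_eq0/negP => /msuppM_le /allpairsP[[c d] /= []].
by rewrite msuppX inE => /eqP-> _ bE; rewrite bE lem_addr in nab.
Qed.

(** A coefficient of [g * F] depends on finitely many coefficients of [F], so
    the identities of the polynomial ring carry over to the action of
    polynomials on series. *)
Lemma mul_poly_seriesE g F b q : (forall a, (a <= b)%MM -> q@_a = F a) ->
  mul_poly_series g F b = (g * q)@_b.
Proof.
move=> qF; rewrite {2}[g]mpolyE mulr_suml raddf_sum /= /mul_poly_series big_mkcond.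
apply: eq_bigr => a _; rewrite -scalerAl mcoeffZ mcoeffXM; case: ifP => ab.
  by rewrite qF // lem_subr.
by rewrite mulr0.
Qed.

Lemma series_trunc F b : exists q, forall a, (a <= b)%MM -> q@_a = F a.
Proof.
exists (\sum_(a : 'X_{1..n < (mdeg b).+1}) F a *: 'X_[a]) => a ab.
by apply: mcoeff_mpoly; rewrite ltnS; exact/lemc_mdeg/lem_leo.
Qed.

Lemma mul_poly_seriesA g q F b :
  mul_poly_series (g * q) F b = mul_poly_series g (mul_poly_series q F) b.
Proof.
have [t tF] := series_trunc F b.
rewrite (mul_poly_seriesE _ tF) -mulrA; apply/esym/mul_poly_seriesE => a ab.
apply/esym/mul_poly_seriesE => c ca; apply: tF; exact: lepm_trans ca ab.
Qed.

Lemma mul_poly_seriesDr g F G b :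
  mul_poly_series g (fun a => F a + G a) b =
  mul_poly_series g F b + mul_poly_series g G b.
Proof. by rewrite -big_split; apply: eq_bigr => a _; rewrite mulrDr. Qed.

Lemma mul_poly_seriesBl g q F b :
  mul_poly_series (g - q) F b = mul_poly_series g F b - mul_poly_series q F b.
Proof.
have [t tF] := series_trunc F b.
by rewrite !(mul_poly_seriesE _ tF) mulrBl mcoeffB.
Qed.

Lemma mul_poly_series1 F b : mul_poly_series 1 F b = F b.
Proof.
have [t tF] := series_trunc F b.
by rewrite (mul_poly_seriesE _ tF) mul1r tF // lepm_refl.
Qed.

Lemma mul_poly_seriesX a F b :
  mul_poly_series 'X_[a] F b = if (a <= b)%MM then F (b - a)%MM else 0.
Proof.
have [t tF] := series_trunc F b.
by rewrite (mul_poly_seriesE _ tF) mcoeffXM tF // lem_subr.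
Qed.

Lemma mul_poly_series_poly g q b : mul_poly_series g (fun a => q@_a) b = (g * q)@_b.
Proof. exact: mul_poly_seriesE. Qed.

Lemma mcoeff0M g q : (g * q)@_0 = g@_0 * q@_0.
Proof. exact: (rmorphM (mcoeff 0%MM)). Qed.

Lemma eq_mul_poly_series g F G b : F =1 G ->
  mul_poly_series g F b = mul_poly_series g G b.
Proof. by move=> FG; apply: eq_bigr => a _; rewrite FG. Qed.

Lemma eq_rational F G : F =1 G -> is_rational_series F -> is_rational_series G.
Proof.
move=> FG [f [g [g0 gF]]]; exists f, g; split=> // b.
by rewrite -gF; apply/esym/eq_mul_poly_series.
Qed.

Lemma rational_poly q : is_rational_series (fun a => q@_a).
Proof.
exists q, 1; split=> [|b]; last by rewrite mul_poly_series1.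
by rewrite mcoeff1 eqxx oner_neq0.
Qed.

Lemma rationalD F G : is_rational_series F -> is_rational_series G ->
  is_rational_series (fun a => F a + G a).
Proof.
move=> [f1 [g1 [g10 gF]]] [f2 [g2 [g20 gG]]].
exists (g2 * f1 + g1 * f2), (g1 * g2); split=> [|b].
  by rewrite mcoeff0M mulf_neq0.
rewrite mul_poly_seriesDr {1}[g1 * g2]mulrC !mul_poly_seriesA.
by rewrite (eq_mul_poly_series _ _ gF) (eq_mul_poly_series _ _ gG)
  !mul_poly_series_poly mcoeffD.
Qed.

Lemma rationalM q F : is_rational_series F -> is_rational_series (mul_poly_series q F).
Proof.
move=> [f [g [g0 gF]]]; exists (q * f), g; split=> // b.
rewrite -mul_poly_seriesA mulrC mul_poly_seriesA (eq_mul_poly_series _ _ gF).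
exact: mul_poly_series_poly.
Qed.

Lemma rational_div q F : q@_0 != 0 ->
  is_rational_series (mul_poly_series q F) -> is_rational_series F.
Proof.
move=> q0 [f [g [g0 gF]]]; exists f, (g * q); split=> [|b].
  by rewrite mcoeff0M mulf_neq0.
by rewrite mul_poly_seriesA.
Qed.

(** * Downward closed sets of coefficient vectors *)

Lemma addmCA a b c : (a + (b + c) = b + (a + c))%MM.
Proof. by rewrite !addmA (addmC a). Qed.

Lemma mulmnDr a i j : (a *+ (i + j) = a *+ i + a *+ j)%MM.
Proof. by apply/mnmP => l; rewrite mnmDE !mulmnE mulnDr. Qed.

Lemma mul0mn i : (0 *+ i = 0 :> 'X_{1..n})%MM.
Proof. by apply/mnmP => l; rewrite mulmnE mnm0E. Qed.

Definition indicator (S : set 'X_{1..n}) : mseries K n := fun a => (`[< S a >])%:R.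

Fixpoint mnm_comb (hs : seq 'X_{1..n}) (u : seq nat) : 'X_{1..n} :=
  if hs is h :: hs' then
    if u is k :: u' then (h *+ k + mnm_comb hs' u')%MM else 0%MM
  else 0%MM.

Definition downset r (D : set (seq nat)) : Prop :=
  (forall u, D u -> size u = r) /\ (forall u v, all2 leq u v -> D v -> D u).

Definition slice (D : set (seq nat)) k : set (seq nat) := [set u | D (k :: u)].

Lemma all2_leq_refl u : all2 leq u u.
Proof. by elim: u => //= k u ->; rewrite leqnn. Qed.

Lemma downset_slice r D k : downset r.+1 D -> downset r (slice D k).
Proof.
move=> [Dr Dle]; split=> [u /Dr[] //|u v uv].
by apply: Dle; rewrite /= leqnn.
Qed.

Lemma sub_slice r D k l : downset r D -> (k <= l)%N -> slice D l `<=` slice D k.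
Proof. by move=> [_ Dle] kl u; apply: Dle; rewrite /= kl all2_leq_refl. Qed.

(** Dickson's lemma, for the complements of the upward closed sets.  Splitting
    off the first coordinate gives slices [slice (D k) j] that decrease in both
    [k] and [j]; beyond the index at which the diagonal [slice (D k) k] is
    stationary all of them agree, and only finitely many sequences, those with
    [j] below this index, remain to be made stationary. *)
Lemma downset_stationary r (D : nat -> set (seq nat)) :
  (forall k, downset r (D k)) -> (forall k l, (k <= l)%N -> D l `<=` D k) ->
  exists k0, forall k, (k0 <= k)%N -> D k = D k0.
Proof.
elim: r D => [|r IH] D Dd Dle.
  have D0 k u : D k u -> u = [::] by move=> /(Dd k).1/size0nil.
  case: (pselect (exists k, ~ D k [::])) => [[k0 nD]|aD].
    exists k0 => k kk; apply/seteqP; split=> u Du; have u0 := D0 _ _ Du.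
      by case: nD; rewrite -u0; exact: Dle Du.
    by case: nD; rewrite -u0.
  have {}aD k : D k [::] by apply: contrapT => nD; apply: aD; exists k.
  by exists 0%N => k _; apply/seteqP; split=> u /D0->.
have [d dP] : exists d, forall k, (d <= k)%N -> slice (D k) k = slice (D d) d.
  apply: IH => [k|k l kl]; first exact: downset_slice.
  apply: subset_trans (sub_slice (Dd l) kl) _ => u; exact: Dle.
have /choice[e eP] : forall j, exists e, forall k, (e <= k)%N -> slice (D k) j = slice (D e) j.
  move=> j; apply: IH => [k|k l kl u]; first exact: downset_slice.
  exact: Dle.
pose M := maxn d (\max_(j < d) e j).
have same k l j : (M <= k)%N -> (k <= l)%N -> slice (D k) j `<=` slice (D l) j.
  move=> Mk kl; case: (ltnP j d) => jd.
    have ej : (e j <= k)%N.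
      apply: leq_trans Mk; apply: leq_trans (leq_maxr _ _).
      exact: (leq_bigmax (Ordinal jd)).
    by rewrite (eP j k) // (eP j l) // (leq_trans ej).
  have dk : (d <= k)%N by apply: leq_trans Mk; exact: leq_maxl.
  apply: (@subset_trans _ (slice (D d) d)).
    apply: subset_trans (sub_slice (Dd k) jd) _ => u; exact: Dle.
  have jl : (d <= maxn j l)%N by rewrite leq_max jd.
  rewrite -(dP _ jl); apply: subset_trans (sub_slice (Dd _) (leq_maxl j l)) _ => u.
  by apply: Dle; exact: leq_maxr.
exists M => k Mk; apply/seteqP; split; first exact: Dle.
move=> [|j u] Du; last exact: (same _ _ _ _ Mk).
by have := (Dd M).1 _ Du.
Qed.

Lemma indicator_translate a S b :
  mul_poly_series 'X_[a] (indicator S) b = indicator [set (a + c)%MM | c in S] b.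
Proof.
rewrite mul_poly_seriesX /indicator; case: ifP => ab.
  congr (nat_of_bool _)%:R; apply: asbool_equiv_eq; split=> [Sc|[c Sc <-]].
    by exists (b - a)%MM => //; rewrite addmC submK.
  by rewrite addmC addmK.
case: asboolP => // -[c _ bE]; by rewrite -bE lem_addr in ab.
Qed.

Lemma indicatorU S T b : (forall a, S a -> ~ T a) ->
  indicator (S `|` T) b = indicator S b + indicator T b.
Proof.
move=> ST; rewrite /indicator -natrD asbool_or; congr (_%:R).
by case: asboolP => Sb; case: asboolP => // Tb; case: (ST b).
Qed.

(** If [T k] is the part of the image coming from the [(k + j) :: u], translated
    so as to count only [j], then the series of [T k] is the sum of the series
    of the [k]-th slice and of [x^h] times the series of [T k.+1].  The slices
    being eventually constant, so is [T], and then [1 - x^h] times the series of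
    [T k] is the series of a slice, to which the induction applies.  If [h = 0]
    this fails, as [1 - x^h = 0], but then injectivity leaves only the slice
    of index 0. *)
Lemma rational_downset hs D : downset (size hs) D ->
  (forall u v, D u -> D v -> mnm_comb hs u = mnm_comb hs v -> u = v) ->
  is_rational_series (indicator (mnm_comb hs @` D)).
Proof.
elim: hs D => [|h hs IH] D Dd comb_inj.
  case: (pselect (D [::])) => D0.
    apply: eq_rational (rational_poly 1) => a; rewrite mcoeff1 /indicator.
    congr (nat_of_bool _)%:R; apply/eqP/asboolP => [->|[u _ <-] //].
    by exists [::].
  apply: eq_rational (rational_poly 0) => a; rewrite mcoeff0 /indicator.
  case: asboolP => // -[u Du _]; case: D0.
  by rewrite -(size0nil (Dd.1 _ Du)).
have Rslice k : is_rational_series (indicator (mnm_comb hs @` slice D k)).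
  apply: IH; first exact: downset_slice Dd.
  by move=> u v Du Dv uv; have [] := comb_inj _ _ Du Dv (congr1 (fun a => h *+ k + a)%MM uv).
pose T k := [set a | exists j u, D ((k + j)%N :: u) /\ a = (h *+ j + mnm_comb hs u)%MM].
have T0 : T 0%N = mnm_comb (h :: hs) @` D.
  apply/seteqP; split=> [_ [j [u [Du ->]]]|_ [u Du <-]]; first by exists (j :: u).
  by case: u Du => [/Dd.1|j u Du] //; exists j, u.
have [h0|h0] := eqVneq h 0%MM.
  apply: eq_rational (Rslice 0%N) => a; rewrite /indicator; congr (nat_of_bool _)%:R.
  apply: asbool_equiv_eq; split=> [[u Du <-]|[u Du <-]].
    by exists (0%N :: u) => //=; rewrite mulm0n add0m.
  case: u Du => [/Dd.1|j u Du] //.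
  have D0u : D (0%N :: u) by apply: (sub_slice Dd (leq0n j)).
  have [j0] : j :: u = 0%N :: u by apply: comb_inj => //=; rewrite h0 !mul0mn.
  by exists u; rewrite -?j0 //= j0 mulm0n add0m.
have TS k a : indicator (T k) a =
    indicator (mnm_comb hs @` slice D k) a + mul_poly_series 'X_[h] (indicator (T k.+1)) a.
  have disj b : (mnm_comb hs @` slice D k) b -> ~ [set (h + c)%MM | c in T k.+1] b.
    move=> [u Du <-] [_ [j [u' [Du' ->]]] e].
    suff [/eqP] : k :: u = (k.+1 + j)%N :: u'
      by rewrite addSn -[X in X == _]addn0 -addnS eqn_add2l.
    by apply: comb_inj => //=; rewrite -e addSnnS mulmnDr mulmS !addmA.
  rewrite indicator_translate -(indicatorU _ disj); congr indicator; apply/seteqP; split.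
    move=> _ [[|j] [u [Du ->]]].
      by left; exists u; [rewrite addn0 in Du | rewrite mulm0n add0m].
    right; exists (h *+ j + mnm_comb hs u)%MM; last by rewrite addmA -mulmS.
    by exists j, u; rewrite addSnnS.
  move=> _ [[u Du <-]|[_ [j [u [Du ->]]] <-]].
    by exists 0%N, u; rewrite addn0 mulm0n add0m.
  by exists j.+1, u; rewrite -addSnnS mulmS addmA.
have [k0 k0P] : exists k0, forall k, (k0 <= k)%N -> slice D k = slice D k0.
  apply: (@downset_stationary (size hs)) => [k|k l kl]; first exact: downset_slice.
  exact: sub_slice Dd kl.
have Tk0 : T k0.+1 = T k0.
  have E j u : D ((k0.+1 + j)%N :: u) = D ((k0 + j)%N :: u).
    have := k0P _ (leq_addr j k0); rewrite -(k0P (k0.+1 + j)%N) ?addSn ?leqW ?leq_addr //.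
    by move=> /(congr1 (@^~ u)).
  by apply/seteqP; split=> a [j [u [Du ->]]]; exists j, u; rewrite E in Du *.
have Rk0 : is_rational_series (indicator (T k0)).
  apply: (@rational_div (1 - 'X_[h])).
    by rewrite mcoeffB mcoeff1 eqxx mcoeffX (negPf h0) subr0 oner_neq0.
  apply: eq_rational (Rslice k0) => a.
  by rewrite mul_poly_seriesBl mul_poly_series1 TS Tk0 addrK.
rewrite -T0; elim: k0 Rk0 {k0P Tk0} => // k IHk Rk; apply: IHk.
apply: eq_rational (rationalD (Rslice k) (rationalM 'X_[h] Rk)) => a.
by rewrite TS.
Qed.


(** * Finitely generated submonoids of [N^n] *)

Definition mnm_span (hs : seq 'X_{1..n}) : set 'X_{1..n} :=
  mnm_comb hs @` [set u | size u = size hs].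

(** The lexicographically least [w] with a given [mnm_comb hs w]: its first
    entry [k] is least when no part [j > 0] of it can be absorbed, with the rest,
    into a combination of the remaining generators. *)
Fixpoint normal_form (hs : seq 'X_{1..n}) : set (seq nat) :=
  if hs is h :: hs' then
    [set w | exists k u, [/\ w = k :: u, normal_form hs' u &
      forall j, (0 < j <= k)%N -> ~ mnm_span hs' (h *+ j + mnm_comb hs' u)%MM]]
  else [set [::]].

Lemma mnm_combD hs u v : size u = size hs -> size v = size hs ->
  mnm_comb hs [seq x.1 + x.2 | x <- zip u v]%N = (mnm_comb hs u + mnm_comb hs v)%MM.
Proof.
elim: hs u v => [|h hs IH] [|k u] [|l v] //=; first by rewrite addm0.
move=> [su] [sv]; rewrite IH // mulmnDr -!addmA; congr (_ + _)%MM.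
by rewrite addmCA.
Qed.

Lemma mnm_spanD hs a b : mnm_span hs a -> mnm_span hs b -> mnm_span hs (a + b)%MM.
Proof.
move=> [u /= su <-] [v /= sv <-]; exists [seq x.1 + x.2 | x <- zip u v]%N.
  by rewrite /= size_map size_zip su sv minnn.
exact: mnm_combD.
Qed.

Lemma normal_form_size hs u : normal_form hs u -> size u = size hs.
Proof. by elim: hs u => [|h hs IH] u /= => [->|[k [v [-> /IH /= -> _]]]]. Qed.

Lemma mnm_comb_le hs u v : all2 leq u v -> size v = size hs ->
  exists2 d, mnm_span hs d & mnm_comb hs v = (d + mnm_comb hs u)%MM.
Proof.
elim: hs u v => [|h hs IH] [|k u] [|l v] //=.
  by move=> _ _; exists 0%MM; [exists [::] | rewrite addm0].
move=> /andP[kl uv] [sv]; have [d [w /= sw dE] ->] := IH _ _ uv sv.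
exists (mnm_comb (h :: hs) ((l - k)%N :: w)); first by exists ((l - k)%N :: w); rewrite //= sw.
by rewrite /= dE -{1}(subnK kl) mulmnDr -!addmA; congr (_ + _)%MM; rewrite addmCA.
Qed.

(** If [j] copies of [h] were absorbed by a smaller sequence, adding to both
    sides what it lacks would absorb them in the larger one. *)
Lemma normal_form_downset hs : downset (size hs) (normal_form hs).
Proof.
split; first exact: normal_form_size.
elim: hs => [|h hs IH] u v /=; first by move=> + v0; rewrite v0; case: u.
move=> uv [l [w [vE nw wl]]]; rewrite {}vE in uv.
case: u uv => [|k u] //= /andP[kl uw].
exists k, u; split=> //; first exact: IH nw.
move=> j /andP[j0 jk] ju; apply: (wl j); first by rewrite j0 (leq_trans jk).
have [d dS ->] := mnm_comb_le uw (normal_form_size nw).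
by rewrite addmCA; exact: mnm_spanD.
Qed.

Lemma normal_form_inj hs u v : normal_form hs u -> normal_form hs v ->
  mnm_comb hs u = mnm_comb hs v -> u = v.
Proof.
elim: hs u v => [|h hs IH] u v /=; first by move=> -> ->.
move=> [k [u' [-> nu uk]]] [l [v' [-> nv vl]]].
wlog kl : k l u' v' nu nv uk vl / (k <= l)%N.
  move=> H; case: (leqP k l) => [kl|/ltnW lk] e; first exact: H e.
  by apply/esym; apply: H (esym e).
move: vl; rewrite -(subnK kl) addnC => vl.
rewrite /= mulmnDr -addmA => /addmI e.
case: (posnP (l - k)%N) => [lk|lk].
  by move: e; rewrite lk addn0 mulm0n add0m => /IH->.
case: (vl (l - k)%N); first by rewrite lk leq_addl.
by rewrite -e; exists u' => //; exact: normal_form_size nu.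
Qed.

Lemma normal_form_span hs : mnm_comb hs @` normal_form hs = mnm_span hs.
Proof.
apply/seteqP; split=> [_ [u nu <-]|].
  by exists u => //; exact: normal_form_size nu.
elim: hs => [_ [u /size0nil-> <-]|h hs IH _ [w sw <-]]; first by exists [::].
pose Q k := exists2 b, mnm_span hs b & mnm_comb (h :: hs) w = (h *+ k + b)%MM.
have exQ : exists k, `[< Q k >].
  case: w sw @Q => [|k u] //= [su]; exists k; apply/asboolP.
  by exists (mnm_comb hs u) => //; exists u.
case: (ex_minnP exQ) => k /asboolP[b bS wE] kmin.
have [u nu uE] := IH _ bS.
exists (k :: u); last by rewrite wE -uE.
exists k, u; split=> // j /andP[j0 jk] jS.
have /kmin : `[< Q (k - j)%N >].
  apply/asboolP; exists (h *+ j + mnm_comb hs u)%MM => //.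
  by rewrite addmA -mulmnDr subnK // uE.
lia.
Qed.

(** Each element of the semigroup has exactly one normal form. *)
Lemma rational_mnm_span hs : is_rational_series (indicator (mnm_span hs)).
Proof.
rewrite -normal_form_span; apply: rational_downset.
  exact: normal_form_downset.
exact: normal_form_inj.
Qed.

Lemma mnm_comb_sum hs u : size u = size hs ->
  mnm_comb hs u = (\sum_(i < size hs) nth 0%MM hs i *+ nth 0%N u i)%MM.
Proof.
elim: hs u => [|h hs IH] [|k u] //=; first by rewrite big_ord0.
by move=> [su]; rewrite big_ord_recl /= IH.
Qed.

Lemma mnm_span_nat_span r (h : 'I_r -> 'X_{1..n}) a :
  mnm_span [tuple h i | i < r] a <-> nat_span (fun i => exp_vec (h i)) (exp_vec a).
Proof.
have E (k : 'I_r -> nat) : exp_vec (\sum_i h i *+ k i)%MM = \sum_i exp_vec (h i) *+ k i.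
  rewrite (big_morph _ (@exp_vecD n) (@exp_vec0 n)).
  by apply: eq_bigr => i _; rewrite exp_vecMn.
have P u : size u = r ->
    mnm_comb [tuple h i | i < r] u = (\sum_i h i *+ nth 0%N u i)%MM.
  move=> su; rewrite mnm_comb_sum ?size_tuple //.
  by apply: eq_bigr => i _; rewrite -tnth_nth tnth_mktuple.
split=> [[u su <-]|[k _ ka]].
  have {}su : size u = r := etrans su (size_tuple _).
  by exists (fun i => nth 0%N u i) => //; rewrite P.
exists [tuple k i | i < r]; first by rewrite /= !size_tuple.
rewrite P ?size_tuple //; apply: exp_vec_inj;
apply: etrans (E (fun i => nth 0%N _ i)) _; rewrite -ka.
by apply: eq_bigr => i _; rewrite -tnth_nth tnth_mktuple.
Qed.

End RationalSeries.

(** * The q-weighted Ehrhart ring *)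

Theorem theorem3p1 (R : realType) (K : fieldType) (iota : {rmorphism R -> K})
    (m s p : nat) (hm : (0 < m)%N) (v : 'I_m -> 'I_s -> nat)
    (w : 'I_p -> {scalar 'rV[R]_s})
    (hw : forall i j, w i (delta_mx 0 j) \is a Num.nat) :
  let vR := fun i => \row_j (v i j)%:R : 'rV[R]_s in
  let P := conv_hull vR in
  let Pw := lifting_polytope vR w in
  [/\ (* (a) *)
      weighted_ehrhart_ring K w P =
        monomial_subring K (weight_exps w (lattice_pts (cone P))) /\
      weighted_ehrhart_ring K w P =
        monomial_subring K (weight_exps w (\bigcup_n dilate_slice P n)),
      (* (b) *)
      is_graded_alg (weighted_ehrhart_ring K w P)
        (weighted_ehrhart_component K w P) /\
      (forall n : nat,
        has_dim (weighted_ehrhart_component K w P n) (ehrhart P n)),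
      (* (c) *)
      ehrhart_ring K Pw = weighted_ehrhart_ring K w P /\
      (forall n : nat, (1 <= n)%N -> ehrhart P n = ehrhart Pw n),
      (* (d) *)
      exists (r : nat) (c : 'I_r -> 'rV[int]_s) (d : 'I_r -> int),
        let h := fun i => with_height (c i) (d i) in
        [/\ lattice_pts (cone P) = nat_span h,
            ehrhart_ring K P = semigroup_ring K h,
            ehrhart_ring K Pw =
              monomial_subring K (weight_exps w (\bigcup_n dilate_slice P n))
          & ehrhart_ring K Pw =
              monomial_subring K (weight_exps w (range h))]
    & (* (e) *)
      is_rational_series (weighted_ehrhart_series K w P)].
Proof.
move=> vR P Pw.
have [W [W0 wE]] := weight_matrix hw.
pose u i : 'rV[int]_s := \row_j (v i j)%:Z.
have vE : vR = fun i => int_vec R (u i).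
  by apply: funext => i; apply/rowP => j; rewrite !mxE.
have u0 i j : 0 <= u i 0 j by rewrite mxE.
move: @P @Pw; rewrite vE => P Pw.
pose C := lattice_pts (cone P).
have C0 : C 0 by exact: lattice_cone0.
have CD a b : C a -> C b -> C (a + b) by exact: lattice_coneD.
have Cslices : C = \bigcup_n dilate_slice P n by exact: lattice_cone_slices.
have weightE := weight_exps_lift wE.
have lCge0 a : (lift W @` C) a -> forall j, 0 <= a 0 j.
  by move=> [b Cb <-]; apply: lift_ge0 => //; exact: lattice_cone_ge0 Cb.
have ringPw : ehrhart_ring K Pw = weighted_ehrhart_ring K w P.
  by rewrite /weighted_ehrhart_ring /ehrhart_ring weightE (lattice_cone_lifting wE).
have ringE : weighted_ehrhart_ring K w P = supported K (lift W @` C).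
  rewrite /weighted_ehrhart_ring weightE; apply: monomial_subring_submonoid.
    by exists 0 => //; exact: lift0.
  by move=> _ _ [a Ca <-] [b Cb <-]; exists (a + b); [exact: CD | exact: liftD].
have ringU : weighted_ehrhart_ring K w P =
    monomial_subring K (weight_exps w (\bigcup_n dilate_slice P n)).
  by rewrite -Cslices.
have compE n : weighted_ehrhart_component K w P n =
    supported K (lift W @` dilate_slice P n).
  by rewrite /weighted_ehrhart_component weightE lin_span_monomials.
have [r [h hE]] := gordan R u hm.
pose g i := mnm_of (lift W (h i)).
have gE i : exp_vec (g i) = lift W (h i).
  apply: mnm_ofK; apply: lCge0; exists (h i) => //.
  by rewrite /C hE; apply: sub_nat_span; exists i.
have spanE : weight_exps w C = nat_span (fun i => exp_vec (g i)).
  by rewrite weightE /C hE lift_nat_span (funext gE).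
split=> //.
- split=> [|n]; last first.
    rewrite compE.
    have -> : ehrhart P n = #|` fset_set (lift W @` dilate_slice P n)|.
      rewrite /ehrhart /dilate_slice image_comp fset_set_image; last exact: finite_dilate.
      rewrite card_imfset // => a b /lift_inj e.
      by have [] := with_height_inj e.
    apply: has_dim_supported; first exact/finite_image/finite_dilate_slice.
    move=> _ [b bn <-]; apply: lCge0; exists b => //.
    by rewrite Cslices; exists n.
  rewrite ringE Cslices image_bigcup (funext compE).
  apply: supported_graded.
  + by exists 0; [exact: dilate_slice0 | exact: lift0].
  + move=> i j _ _ [a ai <-] [b bj <-].
    by exists (a + b); [exact: dilate_sliceD | exact: liftD].
  + move=> i j _ [a ai <-] [b bj /lift_inj ba]; rewrite ba in bj.
    exact: dilate_slice_height ai bj.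
- by split=> // n _; exact: (ehrhart_lifting wE).
- exists r, (fun i => lsubmx (h i)), (fun i => rsubmx (h i) 0 0) => h'.
  have -> : h' = h.
    apply: funext => i; rewrite /h'; case: (with_heightP (h i)) => a [n ->].
    by rewrite row_mxKl row_mxKr mxE.
  split=> //.
  + rewrite /ehrhart_ring /semigroup_ring lin_span_monomials -hE.
    exact: monomial_subring_submonoid.
  + by rewrite ringPw.
  rewrite ringPw /weighted_ehrhart_ring spanE weightE image_comp.
  by rewrite -monomial_subring_nat_span (funext gE).
apply: eq_rational (rational_mnm_span K [tuple g i | i < r]) => a.
rewrite /weighted_ehrhart_series spanE /indicator; congr (nat_of_bool _)%:R.
exact/asbool_equiv_eq/mnm_span_nat_span.
Qed.
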